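(* Let $\mathcal M$ be a triangulated category that is a module over a tensor triangulated category $(\mathcal K,\otimes,1)$. Let $SMod(\mathcal M)$ be the set of thick $\mathcal K$-submodules of $\mathcal M$, with the topology having the sets $U(m)=\{\mathcal N\in SMod(\mathcal M) : m\in\mathcal N\}$, $m\in\mathcal M$, as a subbasis of open sets. Let $c:SMod(\mathcal M)\longrightarrow SMod(\mathcal M)$ be an operator that is extensive, order-preserving and of finite type, and let $SMod^c(\mathcal M)=\{\mathcal N\in SMod(\mathcal M) : c(\mathcal N)=\mathcal N\}$ with the subspace topology. Then $SMod^c(\mathcal M)$ is a spectral space having the collection $\{U(m)\cap SMod^c(\mathcal M)\}_{m\in\mathcal M}$ as a basis of quasi-compact open subspaces.
   Context: All categories are assumed to be essentially small. A tensor triangulated category $(\mathcal K,\otimes,1)$ is a triangulated category $\mathcal K$ with a symmetric monoidal product $\otimes:\mathcal K\times\mathcal K\to\mathcal K$ that is exact in each variable, with unit object $1$. A triangulated category $\mathcal M$ is a module over $(\mathcal K,\otimes,1)$ (in the sense of Stevenson) if there is a functor (action) $\ast:\mathcal K\times\mathcal M\to\mathcal M$, exact in each variable, together with natural isomorphisms $(a\otimes b)\ast m\cong a\ast(b\ast m)$ and $1\ast m\cong m$ satisfying the usual pentagon and unit coherence conditions, compatible with exactness and with the translation functors $T_{\mathcal K}$, $T_{\mathcal M}$ (in particular $T_{\mathcal K}(a)\ast m\cong T_{\mathcal M}(a\ast m)\cong a\ast T_{\mathcal M}(m)$, with the usual sign $(-1)^{rs}$ in the comparison $T_{\mathcal K}^r(1)\ast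 T_{\mathcal M}^s(m)\cong T_{\mathcal M}^{r+s}(m)$), and distributing over coproducts whenever they exist. A thick $\mathcal K$-submodule of $\mathcal M$ is a full subcategory $\mathcal L\subseteq\mathcal M$ containing $0$ such that: (a) $a\ast m\in\mathcal L$ for all $a\in\mathcal K$, $m\in\mathcal L$; (b) for $m,m'\in\mathcal M$, $m\oplus m'\in\mathcal L$ if and only if both $m,m'\in\mathcal L$; (c) for any distinguished triangle $m'\to m\to m''$ in $\mathcal M$, if two of $m',m,m''$ lie in $\mathcal L$, so does the third. A submodule is thus determined by its objects (and is closed under isomorphism); inclusions, unions and intersections refer to objects. The collection $SMod(\mathcal M)$ of all thick $\mathcal K$-submodules is a set. For $m\in\mathcal M$, $\mathcal K(m)$ denotes the smallest thick $\mathcal K$-submodule containing $m$. An operator (map of sets) $c:SMod(\mathcal M)\to SMod(\mathcal M)$ is: extensive if $\mathcal N\subseteq c(\mathcal N)$ for each $\mathcal N$; order-preserving if $\mathcal N\subseteq\mathcal N'$ implies $c(\mathcal N)\subseteq c(\mathcal N')$; of finite type if $c(\mathcal N)=\bigcup_{n\in\mathcal N}c(\mathcal K(n))$ for each $\mathcal N$. A spectral space is a topological space homeomorphic to the Zariski spectrum of a commutative ring. *)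

(* Defs.v *)
From HB Require Import structures.
From mathcomp Require Import all_boot all_order all_algebra.
From mathcomp Require Import all_classical topology.

Set Implicit Arguments.
Unset Strict Implicit.
Unset Printing Implicit Defensive.

Import GRing.Theory.

Local Open Scope ring_scope.
Local Open Scope classical_set_scope.

Reserved Notation "g \oc f" (at level 50, left associativity).

Record additiveCat := AdditiveCat {
  Ob :> Type;
  Hom : Ob -> Ob -> zmodType;
  idm : forall x, Hom x x;
  cmp : forall x y z, Hom y z -> Hom x y -> Hom x z;
  cmpA : forall x y z t (h : Hom z t) (g : Hom y z) (f : Hom x y),
    cmp h (cmp g f) = cmp (cmp h g) f;
  cmp1m : forall x y (f : Hom x y), cmp (idm y) f = f;
  cmpm1 : forall x y (f : Hom x y), cmp f (idm x) = f;
  cmpDl : forall x y z (g g' : Hom y z) (f : Hom x y),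
    cmp (g + g') f = cmp g f + cmp g' f;
  cmpDr : forall x y z (g : Hom y z) (f f' : Hom x y),
    cmp g (f + f') = cmp g f + cmp g f';
  zob : Ob;
  zob_initial : forall x (f : Hom zob x), f = 0;
  zob_terminal : forall x (f : Hom x zob), f = 0;
  dsum : Ob -> Ob -> Ob;
  dsum_in1 : forall x y, Hom x (dsum x y);
  dsum_in2 : forall x y, Hom y (dsum x y);
  dsum_pr1 : forall x y, Hom (dsum x y) x;
  dsum_pr2 : forall x y, Hom (dsum x y) y;
  dsum_pr1in1 : forall x y, cmp (dsum_pr1 x y) (dsum_in1 x y) = idm x;
  dsum_pr2in2 : forall x y, cmp (dsum_pr2 x y) (dsum_in2 x y) = idm y;
  dsum_pr1in2 : forall x y, cmp (dsum_pr1 x y) (dsum_in2 x y) = 0;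
  dsum_pr2in1 : forall x y, cmp (dsum_pr2 x y) (dsum_in1 x y) = 0;
  dsum_inpr : forall x y,
    cmp (dsum_in1 x y) (dsum_pr1 x y) + cmp (dsum_in2 x y) (dsum_pr2 x y)
    = idm (dsum x y)
}.

Arguments Hom {_} _ _.
Arguments idm {_} _.
Arguments zob {_}.

Notation "g \oc f" := (cmp g f) : ring_scope.

Definition is_iso (C : additiveCat) (x y : C) (f : Hom x y) : Prop :=
  exists g : Hom y x, g \oc f = idm x /\ f \oc g = idm y.

Definition is_coproduct (C : additiveCat) (I : Type) (X : I -> C) (S : C)
    (inj : forall i, Hom (X i) S) : Prop :=
  forall (Y : C) (f : forall i, Hom (X i) Y),
    exists! u : Hom S Y, forall i, u \oc inj i = f i.

Record functor (C D : additiveCat) := Functor {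
  fob :> C -> D;
  fmap : forall x y : C, Hom x y -> Hom (fob x) (fob y);
  fmap1 : forall x, fmap (idm x) = idm (fob x);
  fmapM : forall x y z (g : Hom y z) (f : Hom x y),
    fmap (g \oc f) = fmap g \oc fmap f
}.

Definition additive_functor (C D : additiveCat) (F : functor C D) : Prop :=
  forall (x y : C) (f g : Hom x y), fmap F (f + g) = fmap F f + fmap F g.

(* A functor on the product category C * D.                                   *)
Record bifunctor (C D E : additiveCat) := Bifunctor {
  bob :> C -> D -> E;
  bmap : forall (a a' : C) (m m' : D),
    Hom a a' -> Hom m m' -> Hom (bob a m) (bob a' m');
  bmap1 : forall a m, bmap (idm a) (idm m) = idm (bob a m);
  bmapM : forall (a a' a'' : C) (m m' m'' : D) (f' : Hom a' a'')
      (f : Hom a a') (g' : Hom m' m'') (g : Hom m m'),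
    bmap (f' \oc f) (g' \oc g) = bmap f' g' \oc bmap f g
}.

Section Partial.
Variables (C D E : additiveCat) (B : bifunctor C D E).

Lemma bfix1_map1 (a : C) (m : D) : bmap B (idm a) (idm m) = idm (B a m).
Proof. exact: bmap1. Qed.

Lemma bfix1_mapM (a : C) (x y z : D) (g : Hom y z) (f : Hom x y) :
  bmap B (idm a) (g \oc f) = bmap B (idm a) g \oc bmap B (idm a) f.
Proof. by rewrite -bmapM cmp1m. Qed.

Lemma bfix2_mapM (m : D) (x y z : C) (g : Hom y z) (f : Hom x y) :
  bmap B (g \oc f) (idm m) = bmap B g (idm m) \oc bmap B f (idm m).
Proof. by rewrite -bmapM cmp1m. Qed.

Definition bfix1 (a : C) : functor D E :=
  @Functor D E (B a) (fun x y f => bmap B (idm a) f)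
    (bfix1_map1 a) (@bfix1_mapM a).

Definition bfix2 (m : D) : functor C E :=
  @Functor C E (B ^~ m) (fun x y f => bmap B f (idm m))
    (bfix1_map1 ^~ m) (@bfix2_mapM m).

End Partial.

(* The translation functor is T = sh 1.  It is an auto-equivalence given      *)
(* together with all its powers T^n = sh n, n in Z, and with coherent         *)
(* identifications Id ~ T^0 and T^m T^n ~ T^(m+n), i.e. as a monoidal functor *)
(* from Z to endofunctors; a strict automorphism T is the case where these    *)
(* are identities.  The sum is passed as k with a proof of k = m + n so that  *)
(* the associativity law needs no transport.                                  *)
Record triangulatedCat := TriangulatedCat {
  tri_additive :> additiveCat;
  sh : int -> functor tri_additive tri_additive;
  sh_additive : forall n, additive_functor (sh n);
  sh_zero : forall x, Hom x (sh 0 x);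
  sh_add : forall (m n k : int), k = m + n ->
    forall x, Hom (sh m (sh n x)) (sh k x);
  sh_zero_iso : forall x, is_iso (sh_zero x);
  sh_add_iso : forall m n k (e : k = m + n) x, is_iso (sh_add e x);
  sh_zero_nat : forall x y (f : Hom x y),
    fmap (sh 0) f \oc sh_zero x = sh_zero y \oc f;
  sh_add_nat : forall m n k (e : k = m + n) x y (f : Hom x y),
    fmap (sh k) f \oc sh_add e x = sh_add e y \oc fmap (sh m) (fmap (sh n) f);
  sh_add0n : forall n (e : n = 0 + n) x,
    sh_add e x \oc sh_zero (sh n x) = idm (sh n x);
  sh_addn0 : forall n (e : n = n + 0) x,
    sh_add e x \oc fmap (sh n) (sh_zero x) = idm (sh n x);
  sh_addA : forall m n p a b k (ea : a = m + n) (eb : b = n + p)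
      (e1 : k = a + p) (e2 : k = m + b) x,
    sh_add e2 x \oc fmap (sh m) (sh_add eb x)
    = sh_add e1 x \oc sh_add ea (sh p x);
  dist : forall x y z : tri_additive,
    Hom x y -> Hom y z -> Hom z (sh 1 x) -> Prop;
  dist_iso : forall (x y z x' y' z' : tri_additive)
      (f : Hom x y) (g : Hom y z) (h : Hom z (sh 1 x))
      (f' : Hom x' y') (g' : Hom y' z') (h' : Hom z' (sh 1 x'))
      (u : Hom x x') (v : Hom y y') (w : Hom z z'),
    is_iso u -> is_iso v -> is_iso w ->
    v \oc f = f' \oc u -> w \oc g = g' \oc v ->
    fmap (sh 1) u \oc h = h' \oc w ->
    dist f g h -> dist f' g' h';
  dist_id : forall x,
    dist (idm x) (0 : Hom x zob) (0 : Hom zob (sh 1 x));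
  dist_cone : forall x y (f : Hom x y),
    exists z (g : Hom y z) (h : Hom z (sh 1 x)), dist f g h;
  dist_rotate : forall x y z (f : Hom x y) (g : Hom y z) (h : Hom z (sh 1 x)),
    dist f g h <-> dist g h (- fmap (sh 1) f);
  dist_complete : forall (x y z x' y' z' : tri_additive)
      (f : Hom x y) (g : Hom y z) (h : Hom z (sh 1 x))
      (f' : Hom x' y') (g' : Hom y' z') (h' : Hom z' (sh 1 x'))
      (u : Hom x x') (v : Hom y y'),
    dist f g h -> dist f' g' h' -> v \oc f = f' \oc u ->
    exists w : Hom z z',
      w \oc g = g' \oc v /\ fmap (sh 1) u \oc h = h' \oc w;
  dist_octahedral : forall (x y z a b c : tri_additive)
      (f : Hom x y) (g : Hom y z)
      (i : Hom y a) (j : Hom a (sh 1 x))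
      (k : Hom z b) (l : Hom b (sh 1 y))
      (m : Hom z c) (n : Hom c (sh 1 x)),
    dist f i j -> dist g k l -> dist (g \oc f) m n ->
    exists (u : Hom a c) (v : Hom c b),
      [/\ dist u v (fmap (sh 1) i \oc l),
          u \oc i = m \oc g, n \oc u = j,
          v \oc m = k & l \oc v = fmap (sh 1) f \oc n]
}.

Arguments sh {_} _.
Arguments sh_zero {_} _.
Arguments sh_add {_ _ _ _} _ _.

Record exact (C D : triangulatedCat) (F : functor C D) := Exact {
  ex_additive : additive_functor F;
  ex_sh : forall (n : int) (x : C), Hom (F (sh n x)) (sh n (F x));
  ex_sh_iso : forall n x, is_iso (ex_sh n x);
  ex_sh_nat : forall n x y (f : Hom x y),
    ex_sh n y \oc fmap F (fmap (sh n) f)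
    = fmap (sh n) (fmap F f) \oc ex_sh n x;
  ex_sh_zero : forall x, ex_sh 0 x \oc fmap F (sh_zero x) = sh_zero (F x);
  ex_sh_add : forall m n k (e : k = m + n) x,
    ex_sh k x \oc fmap F (sh_add e x)
    = sh_add e (F x) \oc fmap (sh m) (ex_sh n x) \oc ex_sh m (sh n x);
  ex_dist : forall x y z (f : Hom x y) (g : Hom y z) (h : Hom z (sh 1 x)),
    dist f g h -> dist (fmap F f) (fmap F g) (ex_sh 1 x \oc fmap F h)
}.

Record biexact (C D E : triangulatedCat) (B : bifunctor C D E) := Biexact {
  biex1 : forall a : C, exact (bfix1 B a);
  biex2 : forall m : D, exact (bfix2 B m)
}.

Section BiexactShift.
Variables (C D E : triangulatedCat) (B : bifunctor C D E) (H : biexact B).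

Definition lsh (n : int) (a : C) (m : D) : Hom (B (sh n a) m) (sh n (B a m)) :=
  ex_sh (biex2 H m) n a.

Definition rsh (n : int) (a : C) (m : D) : Hom (B a (sh n m)) (sh n (B a m)) :=
  ex_sh (biex1 H a) n m.

End BiexactShift.

Record ttCat := TTCat {
  tt_tri :> triangulatedCat;
  tens : bifunctor tt_tri tt_tri tt_tri;
  tens_biexact : biexact tens;
  unit1 : tt_tri;
  tassoc : forall a b c, Hom (tens (tens a b) c) (tens a (tens b c));
  tlunit : forall a, Hom (tens unit1 a) a;
  trunit : forall a, Hom (tens a unit1) a;
  tsym : forall a b, Hom (tens a b) (tens b a);
  tassoc_iso : forall a b c, is_iso (tassoc a b c);
  tlunit_iso : forall a, is_iso (tlunit a);
  trunit_iso : forall a, is_iso (trunit a);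
  tassoc_nat : forall a a' b b' c c'
      (f : Hom a a') (g : Hom b b') (h : Hom c c'),
    tassoc a' b' c' \oc bmap tens (bmap tens f g) h
    = bmap tens f (bmap tens g h) \oc tassoc a b c;
  tlunit_nat : forall a a' (f : Hom a a'),
    tlunit a' \oc bmap tens (idm unit1) f = f \oc tlunit a;
  trunit_nat : forall a a' (f : Hom a a'),
    trunit a' \oc bmap tens f (idm unit1) = f \oc trunit a;
  tsym_nat : forall a a' b b' (f : Hom a a') (g : Hom b b'),
    tsym a' b' \oc bmap tens f g = bmap tens g f \oc tsym a b;
  tsymK : forall a b, tsym b a \oc tsym a b = idm (tens a b);
  tens_pentagon : forall a b c d,
    tassoc a b (tens c d) \oc tassoc (tens a b) c d
    = bmap tens (idm a) (tassoc b c d) \oc tassoc a (tens b c) d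
        \oc bmap tens (tassoc a b c) (idm d);
  tens_triangle : forall a b,
    bmap tens (idm a) (tlunit b) \oc tassoc a unit1 b
    = bmap tens (trunit a) (idm b);
  tens_hexagon : forall a b c,
    tassoc b c a \oc tsym a (tens b c) \oc tassoc a b c
    = bmap tens (idm b) (tsym a c) \oc tassoc b a c
        \oc bmap tens (tsym a b) (idm c)
}.

Arguments tens {_}.
Arguments unit1 {_}.

Record ttModule (K : ttCat) (M : triangulatedCat) := TTModule {
  act :> bifunctor K M M;
  act_biexact : biexact act;
  aassoc : forall a b m, Hom (act (tens a b) m) (act a (act b m));
  aunit : forall m, Hom (act unit1 m) m;
  aassoc_iso : forall a b m, is_iso (aassoc a b m);
  aunit_iso : forall m, is_iso (aunit m);
  aassoc_nat : forall a a' b b' m m'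
      (f : Hom a a') (g : Hom b b') (h : Hom m m'),
    aassoc a' b' m' \oc bmap act (bmap tens f g) h
    = bmap act f (bmap act g h) \oc aassoc a b m;
  aunit_nat : forall m m' (f : Hom m m'),
    aunit m' \oc bmap act (idm unit1) f = f \oc aunit m;
  act_pentagon : forall a b c m,
    aassoc a b (act c m) \oc aassoc (tens a b) c m
    = bmap act (idm a) (aassoc b c m) \oc aassoc a (tens b c) m
        \oc bmap act (tassoc a b c) (idm m);
  act_unitr : forall a m,
    bmap act (idm a) (aunit m) \oc aassoc a unit1 m
    = bmap act (trunit a) (idm m);
  act_unitl : forall a m,
    aunit (act a m) \oc aassoc unit1 a m = bmap act (tlunit a) (idm m);
  (* T^n(a) * m ~ T^n(a * m) ~ a * T^n(m) are natural in both variables, and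
     the associator and the unitor are morphisms of exact functors in each
     variable. *)
  act_lsh_nat : forall n a m m' (g : Hom m m'),
    lsh act_biexact n a m' \oc bmap act (idm (sh n a)) g
    = fmap (sh n) (bmap act (idm a) g) \oc lsh act_biexact n a m;
  act_rsh_nat : forall n a a' m (f : Hom a a'),
    rsh act_biexact n a' m \oc bmap act f (idm (sh n m))
    = fmap (sh n) (bmap act f (idm m)) \oc rsh act_biexact n a m;
  aassoc_sh1 : forall n a b m,
    lsh act_biexact n a (act b m) \oc aassoc (sh n a) b m
    = fmap (sh n) (aassoc a b m) \oc lsh act_biexact n (tens a b) m
        \oc bmap act (lsh (tens_biexact K) n a b) (idm m);
  aassoc_sh2 : forall n a b m,
    rsh act_biexact n a (act b m)
        \oc bmap act (idm a) (lsh act_biexact n b m) \oc aassoc a (sh n b) m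
    = fmap (sh n) (aassoc a b m) \oc lsh act_biexact n (tens a b) m
        \oc bmap act (rsh (tens_biexact K) n a b) (idm m);
  aassoc_sh3 : forall n a b m,
    rsh act_biexact n a (act b m)
        \oc bmap act (idm a) (rsh act_biexact n b m) \oc aassoc a b (sh n m)
    = fmap (sh n) (aassoc a b m) \oc rsh act_biexact n (tens a b) m;
  aunit_sh : forall n m,
    fmap (sh n) (aunit m) \oc rsh act_biexact n unit1 m = aunit (sh n m);
  (* The two comparisons T^r(1) * T^s(m) ~ T^(r+s)(m) differ by (-1)^(rs).    *)
  act_sign : forall (r s k : int) (ers : k = r + s) (esr : k = s + r) m,
    sh_add ers m \oc fmap (sh r) (aunit (sh s m))
        \oc lsh act_biexact r unit1 (sh s m)
    = (sh_add esr m \oc fmap (sh s) (fmap (sh r) (aunit m))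
        \oc fmap (sh s) (lsh act_biexact r unit1 m)
        \oc rsh act_biexact s (sh r unit1) m) *~ ((-1 : int) ^ (r * s));
  act_coprod1 : forall (I : Type) (X : I -> K) S inj (m : M) P injP,
    @is_coproduct K I X S inj ->
    @is_coproduct M I (fun i => act (X i) m) P injP ->
    forall u : Hom P (act S m),
      (forall i, u \oc injP i = bmap act (inj i) (idm m)) -> is_iso u;
  act_coprod2 : forall (I : Type) (X : I -> M) S inj (a : K) P injP,
    @is_coproduct M I X S inj ->
    @is_coproduct M I (fun i => act a (X i)) P injP ->
    forall u : Hom P (act a S),
      (forall i, u \oc injP i = bmap act (idm a) (inj i)) -> is_iso u
}.

Section Submodules.
Variables (K : ttCat) (M : triangulatedCat) (A : ttModule K M).

Record thick_submodule (L : set M) : Prop := ThickSubmodule {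
  thick_zero : L zob;
  thick_act : forall (a : K) (m : M), L m -> L (A a m);
  thick_dsum : forall m m' : M, L (dsum m m') <-> L m /\ L m';
  thick_dist1 : forall (x y z : M) (f : Hom x y) (g : Hom y z)
      (h : Hom z (sh 1 x)), dist f g h -> L y -> L z -> L x;
  thick_dist2 : forall (x y z : M) (f : Hom x y) (g : Hom y z)
      (h : Hom z (sh 1 x)), dist f g h -> L x -> L z -> L y;
  thick_dist3 : forall (x y z : M) (f : Hom x y) (g : Hom y z)
      (h : Hom z (sh 1 x)), dist f g h -> L x -> L y -> L z
}.

Record SMod := MkSMod {
  smod_obj :> set M;
  smod_thick : thick_submodule smod_obj
}.

HB.instance Definition _ := gen_eqMixin SMod.
HB.instance Definition _ := gen_choiceMixin SMod.

Definition smod_U (m : M) : set SMod := [set N | smod_obj N m].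

HB.instance Definition _ :=
  @isSubBaseTopological.Build SMod (set SMod) (range smod_U) id.

Lemma thick_submodule_gen (m : M) :
  thick_submodule (\bigcap_(N in smod_U m) smod_obj N).
Proof.
split.
- by move=> N _; apply: thick_zero (smod_thick N).
- by move=> a x Lx N Nm; apply: thick_act (smod_thick N) _ _ (Lx N Nm).
- move=> x y; split=> [Lxy|[Lx Ly] N Nm].
    by split=> N Nm; have [] := (thick_dsum (smod_thick N) x y).1 (Lxy N Nm).
  by apply/(thick_dsum (smod_thick N)); split; [exact: Lx | exact: Ly].
- move=> x y z f g h fgh Ly Lz N Nm.
  by apply: thick_dist1 (smod_thick N) _ _ _ _ _ _ fgh (Ly N Nm) (Lz N Nm).
- move=> x y z f g h fgh Lx Lz N Nm.
  by apply: thick_dist2 (smod_thick N) _ _ _ _ _ _ fgh (Lx N Nm) (Lz N Nm).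
- move=> x y z f g h fgh Lx Ly N Nm.
  by apply: thick_dist3 (smod_thick N) _ _ _ _ _ _ fgh (Lx N Nm) (Ly N Nm).
Qed.

Definition smod_gen (m : M) : SMod := MkSMod (thick_submodule_gen m).

Implicit Types c : SMod -> SMod.

Definition extensive c : Prop :=
  forall N : SMod, smod_obj N `<=` smod_obj (c N).

Definition order_preserving c : Prop :=
  forall N N' : SMod, smod_obj N `<=` smod_obj N' ->
    smod_obj (c N) `<=` smod_obj (c N').

Definition finite_type c : Prop :=
  forall N : SMod,
    smod_obj (c N) = \bigcup_(n in smod_obj N) smod_obj (c (smod_gen n)).

Definition smod_fixed c : set SMod := [set N | c N = N].

Definition smod_fixed_U c (m : M) : set (set_type (smod_fixed c)) :=
  set_val @^-1` smod_U m.

End Submodules.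

Arguments smod_U {K M} A m.
Arguments smod_gen {K M} A m.
Arguments smod_fixed {K M A} c.
Arguments smod_fixed_U {K M A} c m.

(* Prime ideals as arbitrary subsets, over possibly zero rings: the ideals of
   ring_quotient are boolean predicates on nonzero rings. *)
Record prime_ideal (R : comPzRingType) (P : set R) : Prop := PrimeIdeal {
  prime_ideal0 : P 0;
  prime_idealD : forall a b, P a -> P b -> P (a + b);
  prime_idealM : forall a b, P b -> P (a * b);
  prime_ideal1 : ~ P 1;
  prime_ideal_prime : forall a b, P (a * b) -> P a \/ P b
}.

Record Spec (R : comPzRingType) := MkSpec {
  spec_ideal :> set R;
  spec_prime : prime_ideal spec_ideal
}.

HB.instance Definition _ (R : comPzRingType) := gen_eqMixin (Spec R).
HB.instance Definition _ (R : comPzRingType) := gen_choiceMixin (Spec R).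

Section Zariski.
Variable R : comPzRingType.

Definition spec_V (E : set R) : set (Spec R) := [set p | E `<=` spec_ideal p].

Definition spec_open (U : set (Spec R)) : Prop :=
  exists E : set R, U = ~` spec_V E.

Lemma spec_openT : spec_open setT.
Proof.
exists [set 1]; apply/seteqP; split=> // p _ pV.
by case: (prime_ideal1 (spec_prime p)); apply: pV.
Qed.

Lemma spec_openI : setI_closed spec_open.
Proof.
move=> _ _ [E ->] [F ->].
exists [set a * b | a in E & b in F]; rewrite -setCU; congr (~` _).
apply/seteqP; split=> p.
  case=> pV _ [a Ea [b Fb <-]].
    by rewrite mulrC; apply: prime_idealM (spec_prime p) _ _ (pV a Ea).
  by apply: prime_idealM (spec_prime p) _ _ (pV b Fb).
move=> pV; have [pE|/existsNP[a /not_implyP[Ea pa]]] := pselect (spec_V E p).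
  by left.
right=> b Fb; have := pV (a * b) (ex_intro2 _ _ a Ea (ex_intro2 _ _ b Fb erefl)).
by case/(prime_ideal_prime (spec_prime p)).
Qed.

Lemma spec_open_bigU (I : Type) (f : I -> set (Spec R)) :
  (forall i, spec_open (f i)) -> spec_open (\bigcup_i f i).
Proof.
move=> /choice[E fE]; exists (\bigcup_i E i).
rewrite (eq_bigcupr (fun i _ => fE i)) -setC_bigcap; congr (~` _).
apply/seteqP; split=> p.
  by move=> pV a [i _ Ea]; apply: (pV i).
by move=> pV i _ a Ea; apply: pV; exists i.
Qed.

HB.instance Definition _ :=
  isOpenTopological.Build (Spec R) spec_openT spec_openI spec_open_bigU.

End Zariski.

Definition homeomorphic (X Y : topologicalType) : Prop :=
  exists (f : X -> Y) (g : Y -> X),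
    [/\ continuous f, continuous g, cancel f g & cancel g f].

Definition spectral_space (X : topologicalType) : Prop :=
  exists R : comPzRingType, homeomorphic X (Spec R).

(* Main.v *)
(** The fixed submodules are exactly the ideals of a join-semilattice: the
    objects of [M] under the direct sum, [n] being below [m] when every fixed
    submodule containing [m] contains [n].  The least fixed submodule containing
    [m] is then the closed point of [U(m)], which gives quasi-compactness.

    Spectrality follows Hochster's method, which becomes explicit for a space [X]
    of ideals.  Let [K] be the field of rational functions in variables [t_i]
    indexed by the semilattice and [K_x] the subfield of those in the [t_i] with
    [i] in [x], so that [K_x] is contained in [K_y] for [x <= y]; let [v_x] be the
    order of vanishing along [t_i = 0] for all [i] outside [x], which is trivial on
    [K_x].  Let [R] consist of the families [f_x] in [K_x] such that
    [v_x (f_y - f_x) > 0] whenever [x <= y], and which are given by restricting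
    finitely many fractions, the choice depending on the trace of [x] on a finite
    set of indices.  Compatibility and finiteness force [{f <> 0}] to be a finite
    union of sets [U(i) = {t_i <> 0}].  If [{f <> 0}] is contained in [{g <> 0}],
    then [g] divides a power of [f] in [R], because the orders of vanishing of [g]
    are bounded by a degree.  Hence every prime of [R] is the set of [f] vanishing
    at a unique point of [X]. *)

From HB Require Import structures.
Require Import Defs.
From mathcomp Require Import all_boot all_order all_algebra.
From mathcomp Require Import all_classical finmap topology.

Set Implicit Arguments.
Unset Strict Implicit.
Unset Printing Implicit Defensive.

Import Order.TTheory GRing.Theory Num.Theory.

Local Open Scope ring_scope.
Local Open Scope classical_set_scope.

(** * Rational polynomials are determined by their values *)

Lemma rat_poly_eq0 (P : {poly rat}) : (forall z, P.[z] = 0) -> P = 0.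
Proof.
move=> P0; apply/eqP; case: eqVneq => // Pn0.
pose rs := [seq (n%:R : rat) | n <- iota 0 (size P)].
have: (size rs < size P)%N.
  apply: max_poly_roots => //.
    by apply/allP => r _; rewrite /root P0.
  by rewrite map_inj_uniq ?iota_uniq // => m n /eqP; rewrite eqr_nat => /eqP.
by rewrite size_map size_iota ltnn.
Qed.

Lemma rat_poly_ext (P Q : {poly rat}) : (forall z, P.[z] = Q.[z]) -> P = Q.
Proof.
move=> PQ; apply/subr0_eq/rat_poly_eq0 => z.
by rewrite hornerD hornerN PQ subrr.
Qed.

(** * Polynomial functions and orders of vanishing *)

Section PolynomialFunctions.
Variable I : choiceType.
Implicit Types (p q : I -> rat) (x y : set I) (F G : (I -> rat) -> rat).

(** Polynomials in possibly infinitely many variables are encoded by their values at rational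
    points: this is faithful over an infinite field, and substitution becomes composition. *)
Inductive polynomial_fun : ((I -> rat) -> rat) -> Prop :=
| Polynomial_const k : polynomial_fun (cst k)
| Polynomial_proj i : polynomial_fun (fun p => p i)
| Polynomial_add F G :
    polynomial_fun F -> polynomial_fun G -> polynomial_fun (fun p => F p + G p)
| Polynomial_mul F G :
    polynomial_fun F -> polynomial_fun G -> polynomial_fun (fun p => F p * G p).

Lemma polynomial_fun_bivariate F (w : I -> {poly {poly rat}}) :
  polynomial_fun F -> exists W : {poly {poly rat}},
    forall s z, F (fun i => (w i).[z%:P].[s]) = W.[z%:P].[s].
Proof.
elim=> {F} [k|i|F G _ [W WE] _ [V VE]|F G _ [W WE] _ [V VE]].
- by exists k%:P%:P => s z; rewrite !hornerC.
- by exists (w i).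
- by exists (W + V) => s z; rewrite !hornerD WE VE.
- by exists (W * V) => s z; rewrite !hornerM WE VE.
Qed.

(** [N] is uniform in the line, like a degree; the bounds on orders of vanishing come from it. *)
Lemma polynomial_fun_degree F : polynomial_fun F -> exists N : nat,
  forall p q, exists2 P : {poly rat}, (size P <= N)%N &
    forall z, F (fun i => p i + z * q i) = P.[z].
Proof.
elim=> {F} [k|i|F G _ [N NP] _ [M MP]|F G _ [N NP] _ [M MP]].
- exists 1%N => p q; exists k%:P; first by rewrite size_polyC_leq1.
  by move=> z; rewrite hornerC.
- exists 2%N => p q; exists ((p i)%:P + (q i)%:P * 'X).
    rewrite addrC size_MXaddC; case: ifP => // _.
    by rewrite ltnS size_polyC_leq1.
  by move=> z; rewrite !hornerE mulrC.
- exists (maxn N M) => p q.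
  have [P sP PE] := NP p q; have [Q sQ QE] := MP p q.
  exists (P + Q); last by move=> z; rewrite PE QE hornerD.
  by rewrite (leq_trans (size_polyD _ _)) // geq_max !leq_max sP sQ orbT.
- exists (N + M)%N => p q.
  have [P sP PE] := NP p q; have [Q sQ QE] := MP p q.
  exists (P * Q); last by move=> z; rewrite PE QE hornerM.
  by rewrite (leq_trans (size_polyMleq _ _)) // (leq_trans (leq_pred _)) // leq_add.
Qed.

Lemma polynomial_fun_support F : polynomial_fun F ->
  exists S : seq I, forall p q, (forall i, i \in S -> p i = q i) -> F p = F q.
Proof.
elim=> {F} [k|i|F G _ [S SP] _ [T TP]|F G _ [S SP] _ [T TP]].
- by exists [::].
- by exists [:: i] => p q; apply; rewrite mem_head.
- by exists (S ++ T) => p q pq; rewrite (SP p q) ?(TP p q) // => i Si;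
    apply: pq; rewrite mem_cat Si ?orbT.
- by exists (S ++ T) => p q pq; rewrite (SP p q) ?(TP p q) // => i Si;
    apply: pq; rewrite mem_cat Si ?orbT.
Qed.

(** The order in [z] measures vanishing along [t_i = 0] for all [i] outside [x]; [z = 0] kills these
    variables. *)
Definition scale_off x (z : rat) p : I -> rat :=
  fun i => if `[< x i >] then p i else z * p i.

Lemma scale_off1 x p : scale_off x 1 p = p.
Proof. by apply/funext => i; rewrite /scale_off mul1r if_same. Qed.

Lemma scale_offM x z z' p :
  scale_off x z (scale_off x z' p) = scale_off x (z * z') p.
Proof.
by apply/funext => i; rewrite /scale_off; case: asboolP => // _; rewrite mulrA.
Qed.

Lemma scale_off_0sub x y z p : x `<=` y ->
  scale_off y z (scale_off x 0 p) = scale_off x 0 p.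
Proof.
move=> xy; apply/funext => i; rewrite /scale_off.
case: asboolP => // yi; case: asboolP => [/xy//|_].
by rewrite mul0r mulr0.
Qed.

Lemma polynomial_fun_scale_off F x k :
  polynomial_fun F -> polynomial_fun (F \o scale_off x k).
Proof.
elim=> {F} [c|i|F G _ + _|F G _ + _].
- exact: Polynomial_const.
- rewrite /scale_off /comp; case: asboolP => _; first exact: Polynomial_proj.
  by apply: (Polynomial_mul (Polynomial_const k)); apply: Polynomial_proj.
- exact: Polynomial_add.
- exact: Polynomial_mul.
Qed.

Definition polynomial_pred : {pred (I -> rat) -> rat} :=
  fun F => `[< polynomial_fun F >].

Lemma polynomial_subring : subring_closed polynomial_pred.
Proof.
split=> [|F G /asboolP hF /asboolP hG|F G /asboolP hF /asboolP hG].
- by apply/asboolP/(Polynomial_const 1).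
- apply/asboolP; have := Polynomial_add hF
    (Polynomial_mul (Polynomial_const (-1)) hG).
  by congr polynomial_fun; apply/funext => p; rewrite mulN1r.
- by apply/asboolP; apply: Polynomial_mul.
Qed.

Record polyfun := Polyfun {
  polyfun_val :> (I -> rat) -> rat;
  polyfunP : polyfun_val \in polynomial_pred
}.

HB.instance Definition _ := [isSub for polyfun_val].
HB.instance Definition _ := [Choice of polyfun by <:].
HB.instance Definition _ := GRing.SubChoice_isSubComPzRing.Build
  _ polynomial_pred polyfun polynomial_subring.

Implicit Types a b : polyfun.

Lemma polyfun_ext a b : (forall p, a p = b p) -> a = b.
Proof. by move=> ab; apply/val_inj/funext. Qed.

Lemma polyfunE :
  (forall p, (0 : polyfun) p = 0) * (forall p, (1 : polyfun) p = 1) *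
  (forall a p, (- a) p = - a p) * (forall a b p, (a + b) p = a p + b p) *
  (forall a b p, (a * b) p = a p * b p).
Proof. by do !split. Qed.

Lemma polyfun1_neq0 : (1 : polyfun) != 0.
Proof.
apply/eqP => /(congr1 (fun a : polyfun => a (fun=> 0))).
by rewrite !polyfunE => /eqP; rewrite oner_eq0.
Qed.

HB.instance Definition _ := GRing.PzSemiRing_isNonZero.Build polyfun polyfun1_neq0.

Definition ordge x n F := forall p, exists P : {poly rat},
  forall z, F (scale_off x z p) = z ^+ n * P.[z].

Lemma ordgeN x n a : ordge x n a -> ordge x n (- a).
Proof.
move=> ga p; have [P PE] := ga p; exists (- P) => z.
by rewrite polyfunE PE hornerN mulrN.
Qed.

Lemma ordgeD x n a b : ordge x n a -> ordge x n b -> ordge x n (a + b).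
Proof.
move=> ga gb p; have [P PE] := ga p; have [Q QE] := gb p; exists (P + Q) => z.
by rewrite polyfunE PE QE hornerD mulrDr.
Qed.

Lemma ordgeM x n m a b :
  ordge x n a -> ordge x m b -> ordge x (n + m) (a * b).
Proof.
move=> ga gb p; have [P PE] := ga p; have [Q QE] := gb p; exists (P * Q) => z.
by rewrite polyfunE PE QE hornerM exprD mulrACA.
Qed.

Lemma ordgeW x n m F : (m <= n)%N -> ordge x n F -> ordge x m F.
Proof.
move=> mn gF p; have [P PE] := gF p; exists ('X^(n - m) * P) => z.
by rewrite PE hornerM hornerXn mulrA -exprD subnKC.
Qed.

Lemma polyfun_line a : exists N : nat,
  forall p q, exists2 P : {poly rat}, (size P <= N)%N &
    forall z, a (fun i => p i + z * q i) = P.[z].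
Proof. by apply: polynomial_fun_degree; apply/asboolP/polyfunP. Qed.

Lemma polyfun_scale_poly a : exists N : nat,
  forall x y p, exists2 P : {poly rat}, (size P <= N)%N &
    forall z, a (scale_off y 0 (scale_off x z p)) = P.[z].
Proof.
have [N aN] := polyfun_line a; exists N => x y p.
(* The point is affine in [z]: its value at 0 is the base point, its slope the direction. *)
have [P sP PE] := aN (scale_off x 0 (scale_off y 0 p))
  (fun i => scale_off y 0 p i - scale_off x 0 (scale_off y 0 p) i).
exists P => // z; rewrite -PE; congr (polyfun_val a _); apply/funext => i.
rewrite /scale_off; case: asboolP => yi; case: asboolP => xi;
  by rewrite ?mul0r ?mulr0 ?subr0 ?add0r ?addr0 // subrr mulr0 addr0.
Qed.

Lemma ordge0 x a : ordge x 0 a.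
Proof.
move=> p; have [N aN] := polyfun_scale_poly a.
have [P _ PE] := aN x setT p; exists P => z.
rewrite expr0 mul1r -PE; congr (polyfun_val a _); apply/funext => i.
by rewrite [RHS]/scale_off asboolT.
Qed.

Lemma ordgeS x n F p (P : {poly rat}) :
  (forall z, F (scale_off x z p) = z ^+ n * P.[z]) -> P.[0] = 0 ->
  exists Q : {poly rat}, forall z, F (scale_off x z p) = z ^+ n.+1 * Q.[z].
Proof.
move=> PE /rootP/factor_theorem[Q QE]; exists Q => z.
by rewrite PE QE hornerM hornerXsubC subr0 mulrA mulrAC exprSr.
Qed.

Lemma ordge1 x a : ordge x 1 a <-> forall p, a (scale_off x 0 p) = 0.
Proof.
split=> [ga p|a0 p].
  by have [P ->] := ga p; rewrite expr1 mul0r.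
have [P PE] := ordge0 x a p.
by apply: (ordgeS PE); have := PE (0 : rat); rewrite a0 expr0 mul1r => <-.
Qed.

Lemma ordge_exact x a n : ~ ordge x n a -> exists m : nat,
  [/\ (m < n)%N, ordge x m a & ~ ordge x m.+1 a].
Proof.
elim: n => [/(_ (ordge0 x a))//|n IH] gn.
have [gn'|/IH[m [mn gm gm']]] := pselect (ordge x n a); first by exists n.
by exists m; split=> //; apply: ltnW.
Qed.

Definition ord_eq x n a := ordge x n a /\ ~ ordge x n.+1 a.

(* Leading coefficients in [z] are polynomial along the line joining two points
   at which they do not vanish, so their product is not identically zero. *)
Lemma ord_eqM x n m a b :
  ord_eq x n a -> ord_eq x m b -> ord_eq x (n + m) (a * b).
Proof.
move=> [ga na] [gb nb]; split; first exact: ordgeM.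
have lead k c : ordge x k c -> ~ ordge x k.+1 c ->
    exists p (P : {poly rat}),
      (forall z, c (scale_off x z p) = z ^+ k * P.[z]) /\ P.[0] != 0.
  move=> gc /existsNP[p np]; have [P PE] := gc p; exists p, P; split=> //.
  by apply/eqP => P0; apply: np; apply: ordgeS P0.
have [p [P [PE P0]]] := lead _ _ ga na.
have [q [Q [QE Q0]]] := lead _ _ gb nb.
(* The line [r] goes from [p] at 0 to [q] at 1. In [w] the outer variable is [z], the inner one the
   parameter of this line. *)
pose r i : {poly rat} := (p i)%:P + (q i - p i)%:P * 'X.
pose w i : {poly {poly rat}} :=
  if `[< x i >] then (r i)%:P else 'X * (r i)%:P.
have wE s z : (fun i => (w i).[z%:P].[s]) = scale_off x z (fun i => (r i).[s]).
  apply/funext => i; rewrite /w /scale_off; case: asboolP => _.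
    by rewrite hornerC.
  by rewrite hornerM hornerX hornerC hornerM hornerC.
have coef k (W : {poly {poly rat}}) (V : {poly rat}) s :
    (forall z, W.[z%:P].[s] = z ^+ k * V.[z]) -> (W`_k).[s] = V.[0].
  move=> WV; have : map_poly (horner_eval s) W = 'X^k * V.
    apply: rat_poly_ext => z; rewrite hornerM hornerXn -WV.
    by rewrite -[in LHS](hornerC z s) horner_map.
  move/(congr1 (coefp k)); rewrite /= coef_map /= horner_evalE => ->.
  by rewrite coefXnM ltnn subnn horner_coef0.
have [W WE] := polynomial_fun_bivariate w (asboolW (polyfunP a)).
have [V VE] := polynomial_fun_bivariate w (asboolW (polyfunP b)).
have r0 : (fun i => (r i).[0]) = p.
  by apply/funext => i; rewrite /r !hornerE.
have r1 : (fun i => (r i).[1]) = q.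
  by apply/funext => i; rewrite /r hornerD hornerM hornerX !hornerC mulr1 addrC
    subrK.
have Wn0 : W`_n != 0.
  apply/eqP => W0; move/eqP: P0; apply.
  rewrite -(coef n W P 0) ?W0 ?horner0 // => z.
  by rewrite -WE wE r0 PE.
have Vm0 : V`_m != 0.
  apply/eqP => V0; move/eqP: Q0; apply.
  rewrite -(coef m V Q 1) ?V0 ?horner0 // => z.
  by rewrite -VE wE r1 QE.
move=> gab; suff: W`_n * V`_m = 0.
  by move/eqP; rewrite mulf_eq0 (negbTE Wn0) (negbTE Vm0).
apply: rat_poly_eq0 => s; pose rs i := (r i).[s].
have [P' PE'] := ga rs; have [Q' QE'] := gb rs; have [H HE] := gab rs.
rewrite hornerM (coef n W P') => [|z]; last by rewrite -WE wE PE'.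
rewrite (coef m V Q') => [|z]; last by rewrite -VE wE QE'.
(* Cancelling ['X^(n + m)] shows that ['X] divides [P' * Q'], whose value at 0 is the product of the
   leading coefficients at [s]. *)
have : 'X^(n + m) * (P' * Q') = 'X^(n + m) * ('X * H).
  apply: rat_poly_ext => z; rewrite !hornerM !hornerXn hornerX [RHS]mulrA -exprSr.
  by rewrite -HE polyfunE PE' QE' exprD mulrACA.
move/mulfI => /(_ (monic_neq0 (monicXn _ _))) PQ.
by rewrite -hornerM PQ hornerM hornerX mul0r.
Qed.

Lemma ordgeT a : ordge setT 1 a <-> a = 0.
Proof.
rewrite ordge1; split=> [a0|-> p]; last by rewrite polyfunE.
apply: polyfun_ext => p; rewrite polyfunE -(a0 p); congr (polyfun_val a _).
by apply/funext => i; rewrite /scale_off asboolT.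
Qed.

(** For [x = setT] nothing is scaled, so nonzero elements have order exactly 0, and additivity of
    the order excludes zero divisors. *)
Lemma polyfun_integral a b : a * b = 0 -> (a == 0) || (b == 0).
Proof.
move=> ab0; apply/orP; apply: contrapT => /not_orP[/negP/eqP an0 /negP/eqP bn0].
have ord0 (c : polyfun) : c <> 0 -> ord_eq setT 0 c.
  by move=> c0; split; [exact: ordge0|move/ordgeT].
have [_] := ord_eqM (ord0 _ an0) (ord0 _ bn0).
by apply; apply/ordgeT.
Qed.

Definition polyfun_unit : {pred polyfun} := fun a => `[< exists b, b * a = 1 >].

Definition polyfun_inv a : polyfun :=
  if pselect (exists b, b * a = 1) is left e then projT1 (cid e) else a.

Lemma polyfun_mulV : {in polyfun_unit, left_inverse 1 polyfun_inv *%R}.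
Proof.
by move=> a /asboolP ua; rewrite /polyfun_inv; case: pselect => // e; case: cid.
Qed.

Lemma polyfun_unitP a b : b * a = 1 -> a \in polyfun_unit.
Proof. by move=> ba; apply/asboolP; exists b. Qed.

Lemma polyfun_inv_out : {in [predC polyfun_unit], polyfun_inv =1 id}.
Proof. by move=> a /asboolPn ua; rewrite /polyfun_inv; case: pselect. Qed.

HB.instance Definition _ := GRing.ComNzRing_hasMulInverse.Build polyfun
  polyfun_mulV polyfun_unitP polyfun_inv_out.
HB.instance Definition _ :=
  GRing.ComUnitRing_isIntegral.Build polyfun polyfun_integral.

End PolynomialFunctions.

Local Notation "x %:F" := (@FracField.tofrac _ x).

Lemma div_sub_div (F : fieldType) (a b c d : F) : b != 0 -> d != 0 ->
  a / b - c / d = ((a - c) * d - c * (b - d)) / (b * d).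
Proof.
move=> b0 d0; rewrite -mulNr addf_div //; congr (_ / _).
by rewrite mulrBl mulrBr opprB addrA subrK mulNr.
Qed.

(** * The valuations [v_x] on the fraction field *)

Section Valuations.
Variable I : choiceType.
Implicit Types (x y : set I) (a b : polyfun I) (u v : {fraction (polyfun I)}).

Lemma ord_eq_neq0 x n a : ord_eq x n a -> a != 0.
Proof.
move=> [_ na]; apply/eqP => a0; apply: na => p; exists 0 => z.
by rewrite a0 polyfunE horner0 mulr0.
Qed.

Lemma restr_subproof y a :
  (fun p => a (scale_off y 0 p)) \in @polynomial_pred I.
Proof.
by apply/asboolP/polynomial_fun_scale_off; apply/asboolP; exact: polyfunP.
Qed.

(* The quotient map sending the variables outside [y] to [0], followed by the
   inclusion of polynomials in the variables of [y]. *)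
Definition restr y a : polyfun I := Polyfun (restr_subproof y a).

Lemma restr0 y : restr y 0 = 0.
Proof. exact: polyfun_ext. Qed.

Lemma restr1 y : restr y 1 = 1.
Proof. exact: polyfun_ext. Qed.

Lemma restrN y a : restr y (- a) = - restr y a.
Proof. exact: polyfun_ext. Qed.

Lemma restrD y a b : restr y (a + b) = restr y a + restr y b.
Proof. exact: polyfun_ext. Qed.

Lemma restrM y a b : restr y (a * b) = restr y a * restr y b.
Proof. exact: polyfun_ext. Qed.

Lemma ord_eq_restr x a : restr x a != 0 -> ord_eq x 0 (restr x a).
Proof.
move=> a0; split; first exact: ordge0.
move/ordge1 => r0; move/eqP: a0; apply; apply: polyfun_ext => p.
by rewrite polyfunE -(r0 p) /= scale_offM mul0r.
Qed.

(** Along a scaling curve the values form a polynomial in [z] of size at most [N]. Divisibility by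
    [z^(N+1)] would make it 0, and [z = 1] recovers the value at [p]. *)
Lemma restr_degree a : exists N : nat, forall x y,
  restr y a != 0 -> exists2 k, (k <= N)%N & ord_eq x k (restr y a).
Proof.
have [N aN] := polyfun_scale_poly a; exists N => x y ra0.
have : ~ ordge x N.+1 (restr y a).
  move=> ge; move/eqP: ra0; apply; apply: polyfun_ext => p.
  have [P sP PE] := aN x y p; have [Q QE] := ge p.
  have PQ : P = 'X^(N.+1) * Q.
    by apply: rat_poly_ext => z; rewrite hornerM hornerXn -QE -PE.
  have Q0 : Q = 0.
    apply/eqP; apply: contraTT sP => Qn0; rewrite PQ -ltnNge mulrC.
    by rewrite size_mulXn // leq_addr.
  by rewrite -[p in LHS](scale_off1 x) /= PE PQ Q0 mulr0 horner0.
by case/ordge_exact => k [kN ? ?]; exists k.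
Qed.

(** This encodes [v_x(u) >= e] through one fraction equal to [u], which avoids negative values and a
    special value at [u = 0]. *)
Definition val_ge x (e : nat) u := exists a b n,
  [/\ u = a%:F / b%:F, ordge x (n + e) a & ord_eq x n b].

Lemma val_geW x e e' u : (e' <= e)%N -> val_ge x e u -> val_ge x e' u.
Proof.
move=> ee [a [b [n [-> ga eb]]]]; exists a, b, n; split=> //.
by apply: ordgeW ga; rewrite leq_add2l.
Qed.

Lemma val_geN x e u : val_ge x e u -> val_ge x e (- u).
Proof.
move=> [a [b [n [-> ga eb]]]]; exists (- a), b, n; split=> //.
  by rewrite tofracN mulNr.
exact: ordgeN.
Qed.

Lemma val_geD x e u v : val_ge x e u -> val_ge x e v -> val_ge x e (u + v).
Proof.
move=> [a [b [n [-> ga eb]]]] [a' [b' [n' [-> ga' eb']]]].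
exists (a * b' + a' * b), (b * b'), (n + n')%N; split; last exact: ord_eqM.
  rewrite addf_div ?tofrac_eq0 ?(ord_eq_neq0 eb) ?(ord_eq_neq0 eb') //.
  by rewrite tofracD !tofracM.
apply: ordgeD; first by rewrite addnAC; apply: ordgeM ga (eb'.1).
by rewrite -addnA addnC; apply: ordgeM ga' (eb.1).
Qed.

Lemma val_geB x e u v : val_ge x e u -> val_ge x e v -> val_ge x e (u - v).
Proof. by move=> gu gv; apply/val_geD/val_geN. Qed.

Lemma val_geM x e e' u v :
  val_ge x e u -> val_ge x e' v -> val_ge x (e + e') (u * v).
Proof.
move=> [a [b [n [-> ga eb]]]] [a' [b' [n' [-> ga' eb']]]].
exists (a * a'), (b * b'), (n + n')%N; split; last exact: ord_eqM.
  by rewrite !tofracM invfM mulrACA.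
by rewrite addnACA; apply: ordgeM.
Qed.

Lemma val_ge0 x e : val_ge x e 0.
Proof.
exists 0, 1, 0%N; split; first by rewrite tofrac0 mul0r.
  by move=> p; exists 0 => z; rewrite horner0 mulr0.
by rewrite -(restr1 x); apply: ord_eq_restr; rewrite restr1 oner_neq0.
Qed.

Lemma val_ge_restr x a b :
  restr x b != 0 -> val_ge x 0 ((restr x a)%:F / (restr x b)%:F).
Proof.
move=> b0; exists (restr x a), (restr x b), 0%N; split=> //.
  exact: ordge0.
exact: ord_eq_restr.
Qed.

(** This is the triviality of [v_x] on [K_x]. After cross-multiplication, [restr x a * b'] would
    have order exactly [n] if [restr x a] were nonzero, while [a' * restr x b] has order at least
    [n + 1]. *)
Lemma val_ge1_restr x a b : restr x b != 0 ->
  val_ge x 1 ((restr x a)%:F / (restr x b)%:F) ->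
  (restr x a)%:F / (restr x b)%:F = 0.
Proof.
move=> b0 [a' [b' [n [E ga' eb']]]].
have [->|a0] := eqVneq (restr x a) 0; first by rewrite tofrac0 mul0r.
have : restr x a * b' = a' * restr x b.
  apply/eqP; rewrite -tofrac_eq !tofracM.
  by rewrite -eqr_div ?tofrac_eq0 ?(ord_eq_neq0 eb') // E.
have [_] := ord_eqM (ord_eq_restr a0) eb'.
rewrite add0n => nab ab; case: nab; rewrite ab.
by rewrite -addn1 -[(n + 1)%N]addn0; apply: ordgeM ga' (ordge0 _ _).
Qed.

Lemma val_geV x u : val_ge x 0 u -> ~ val_ge x 1 u -> val_ge x 0 u^-1.
Proof.
move=> [a [b [n [-> ga eb]]]] nu; exists b, a, n; split.
- by rewrite invf_div.
- by rewrite addn0; apply: eb.1.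
- split; first by rewrite addn0 in ga.
  by move=> ga'; apply: nu; exists a, b, n; rewrite addn1.
Qed.

Lemma val_geX x u n : val_ge x 1 u -> val_ge x n (u ^+ n).
Proof.
move=> gu; elim: n => [|n IH]; last by rewrite exprS -add1n; apply: val_geM.
rewrite expr0 -[1](divff (oner_neq0 _)) -tofrac1 -(restr1 x).
by apply: val_ge_restr; rewrite restr1 oner_neq0.
Qed.

Lemma val_ge_div x k n a b u : val_ge x (k + n) u -> ord_eq x k a ->
  val_ge x n (u / (a%:F / b%:F)).
Proof.
move=> [a' [b' [m [-> ga' eb']]]] ea; exists (a' * b), (b' * a), (m + k)%N.
split; last exact: ord_eqM.
  by rewrite invf_div mulf_div !tofracM.
by rewrite -addnA -[(m + _)%N]addn0; apply: ordgeM ga' (ordge0 _ _).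
Qed.

End Valuations.

(** * Points with the same trace on finitely many indices *)

Section FiniteTraces.
Variables (I : choiceType) (X : Type) (el : X -> set I).

Definition agree (J : seq I) (x y : X) :=
  forall i, i \in J -> el x i <-> el y i.

Lemma agree_sym J x y : agree J x y -> agree J y x.
Proof. by move=> xy i iJ; split=> /(xy i iJ). Qed.

Lemma agree_trans J x y z : agree J x y -> agree J y z -> agree J x z.
Proof. by move=> xy yz i iJ; rewrite (xy i iJ); exact: yz. Qed.

Lemma agree_catl J K x y : agree (J ++ K) x y -> agree J x y.
Proof. by move=> xy i iJ; apply: xy; rewrite mem_cat iJ. Qed.

Lemma agree_catr J K x y : agree (J ++ K) x y -> agree K x y.
Proof. by move=> xy i iJ; apply: xy; rewrite mem_cat iJ orbT. Qed.

(* There are finitely many traces on [J], so bounds on each class of points with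
   the same trace combine into a global one. *)
Lemma finite_traces (B : Type) (Q : B -> X -> Prop) (J : seq I) :
  inhabited B ->
  (forall b c, exists d, forall x, Q b x \/ Q c x -> Q d x) ->
  (forall x, exists b, forall y, agree J x y -> Q b y) ->
  exists b, forall x, Q b x.
Proof.
move=> [b0] Qj QJ.
suff [b Qb] : exists b, forall x, setT x -> Q b x by exists b => x; apply: Qb.
have {QJ} : forall x, setT x ->
    exists b, forall y, setT y -> agree J x y -> Q b y.
  by move=> x _; have [b Qb] := QJ x; exists b => y _; exact: Qb.
(* The induction runs over all subsets [Y] of points: the index [j] splits [Y] in two, and [Qj]
   merges the bounds found on the two pieces. *)
elim: J (@setT X) => [|j J IH] Y QJ.
  have [[x Yx]|nY] := pselect (exists x, Y x).
    by have [b Qb] := QJ x Yx; exists b => y Yy; apply: Qb.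
  by exists b0 => x Yx; case: nY; exists x.
have [|b Qb] := IH (Y `&` [set x | el x j]).
  move=> x [Yx xj]; have [b Qb] := QJ x Yx; exists b => y [Yy yj] xy.
  by apply: Qb => // i; rewrite in_cons => /predU1P[->|]; [split|exact: xy].
have [|c Qc] := IH (Y `&` [set x | ~ el x j]).
  move=> x [Yx xj]; have [c Qc] := QJ x Yx; exists c => y [Yy yj] xy.
  by apply: Qc => // i; rewrite in_cons => /predU1P[->|]; [split|exact: xy].
have [d Qd] := Qj b c; exists d => x Yx; apply: Qd.
by have [xj|xj] := pselect (el x j); [left; apply: Qb|right; apply: Qc].
Qed.

End FiniteTraces.

(** * The ring of a space of subsets *)

Section Spring.
Variables (I : choiceType) (X : Type) (el : X -> set I).
Local Notation K := {fraction (polyfun I)}.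
Implicit Types (x y : X) (f g h : X -> K).

Definition compatible f :=
  forall x y, el x `<=` el y -> val_ge (el x) 1 (f y - f x).

Definition represents y (a b : polyfun I) (u : K) :=
  restr (el y) b != 0 /\ u = (restr (el y) a)%:F / (restr (el y) b)%:F.

Definition piecewise_rational f := exists J : seq I, forall x, exists a b,
  forall y, agree el J x y -> represents y a b (f y).

Definition spring_pred : {pred X -> K} :=
  fun f => `[< compatible f /\ piecewise_rational f >].

Lemma piecewise_rational_val_ge f x : piecewise_rational f ->
  val_ge (el x) 0 (f x).
Proof.
move=> [J fJ]; have [a [b fab]] := fJ x.
by have [b0 ->] := fab x (fun _ _ => iff_refl _); apply: val_ge_restr.
Qed.

Lemma piecewise_rational_val_ge1 f x : piecewise_rational f ->
  val_ge (el x) 1 (f x) -> f x = 0.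
Proof.
move=> [J fJ]; have [a [b fab]] := fJ x.
by have [b0 ->] := fab x (fun _ _ => iff_refl _); apply: val_ge1_restr.
Qed.

Lemma compatible_val_ge f x y : el x `<=` el y ->
  compatible f -> piecewise_rational f -> val_ge (el x) 0 (f y).
Proof.
move=> xy cf rf; rewrite -(subrK (f x) (f y)); apply: val_geD.
  by apply: val_geW (cf _ _ xy).
exact: piecewise_rational_val_ge.
Qed.

Lemma spring_subring : subring_closed spring_pred.
Proof.
split=> [|f g /asboolP[cf rf] /asboolP[cg rg]|f g /asboolP[cf rf] /asboolP[cg rg]].
- apply/asboolP; split=> [x y _|]; first by rewrite subrr; exact: val_ge0.
  exists [::] => x; exists 1, 1 => y _; split; first by rewrite restr1 oner_neq0.
  by rewrite restr1 divff // tofrac_eq0 oner_neq0.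
- apply/asboolP; split=> [x y xy|].
    have -> : (f - g) y - (f - g) x = (f y - f x) - (g y - g x).
      by rewrite !opprD !opprK addrACA.
    by apply: val_geB; [exact: cf|exact: cg].
  have [J fJ] := rf; have [L gL] := rg; exists (J ++ L) => x.
  have [a [b fab]] := fJ x; have [c [d gcd]] := gL x.
  exists (a * d - c * b), (b * d) => y xy.
  have [b0 fE] := fab y (agree_catl xy); have [d0 gE] := gcd y (agree_catr xy).
  split; first by rewrite restrM mulf_neq0.
  have -> : (f - g) y = f y - g y by [].
  rewrite fE gE restrD restrN !restrM tofracB !tofracM.
  by rewrite -mulNr addf_div ?tofrac_eq0 // mulNr.
- apply/asboolP; split=> [x y xy|].
    have -> : (f * g) y - (f * g) x = (f y - f x) * g y + f x * (g y - g x).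
      by rewrite mulrBl mulrBr addrA subrK.
    apply: val_geD.
      by apply: (@val_geM _ _ 1 0); [exact: cf|exact: (compatible_val_ge xy)].
    apply: (@val_geM _ _ 0 1); last exact: cg.
    exact: piecewise_rational_val_ge.
  have [J fJ] := rf; have [L gL] := rg; exists (J ++ L) => x.
  have [a [b fab]] := fJ x; have [c [d gcd]] := gL x.
  exists (a * c), (b * d) => y xy.
  have [b0 fE] := fab y (agree_catl xy); have [d0 gE] := gcd y (agree_catr xy).
  split; first by rewrite restrM mulf_neq0.
  have -> : (f * g) y = f y * g y by [].
  by rewrite fE gE !restrM !tofracM mulf_div.
Qed.

Record spring := Spring {
  spring_val :> X -> K;
  springP : spring_val \in spring_pred
}.

HB.instance Definition _ := [isSub for spring_val].
HB.instance Definition _ := [Choice of spring by <:].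
HB.instance Definition _ :=
  GRing.SubChoice_isSubComPzRing.Build _ spring_pred spring spring_subring.

Lemma springE :
  (forall x, (0 : spring) x = 0) * (forall x, (1 : spring) x = 1) *
  (forall (f g : spring) x, (f + g) x = f x + g x) *
  (forall (f g : spring) x, (f * g) x = f x * g x).
Proof. by do !split. Qed.

Lemma springX (f : spring) n x : (f ^+ n) x = f x ^+ n.
Proof. by elim: n => // n IH; rewrite !exprS springE IH. Qed.

Lemma spring_ext (f g : spring) : (forall x, f x = g x) -> f = g.
Proof. by move=> fg; apply/val_inj/funext. Qed.

Lemma spring_compatible (f : spring) : compatible f.
Proof. by case/asboolP: (springP f). Qed.

Lemma spring_rational (f : spring) : piecewise_rational f.
Proof. by case/asboolP: (springP f). Qed.

(** If [f y = 0], compatibility makes [v_x(f x)] positive, and [v_x] is trivial on [K_x]. *)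
Lemma spring_up (f : spring) x y : el x `<=` el y -> f x != 0 -> f y != 0.
Proof.
move=> xy; apply: contraNN => /eqP fy0; apply/eqP.
apply: piecewise_rational_val_ge1 (spring_rational f) _.
by have := val_geN (spring_compatible f xy); rewrite fy0 sub0r opprK.
Qed.

(** On a class where [f] is given by [a] over [b], vanishing at [y] means that [a] restricts to 0,
    which depends only on the trace of [y] on a finite support of [a]. *)
Lemma spring_zero_set (f : spring) : exists S : seq I,
  forall x y, agree el S x y -> f x = 0 -> f y = 0.
Proof.
have [J fJ] := spring_rational f.
apply: (@finite_traces _ _ el _ _ J).
- by constructor; exact: [::].
- move=> S T; exists (S ++ T) => x [] fx y xy; apply: fx.
    exact: agree_catl xy.
  exact: agree_catr xy.
move=> x; have [a [b fab]] := fJ x.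
have [S aS] := polynomial_fun_support (asboolW (polyfunP a)).
exists (J ++ S) => y xy z yz.
have [b0 ->] := fab y xy.
have [b0' ->] := fab z (agree_trans xy (agree_catl yz)).
move/eqP; rewrite mulf_eq0 invr_eq0 !tofrac_eq0 (negbTE b0) orbF => /eqP a0.
rewrite (_ : restr (el z) a = 0) ?tofrac0 ?mul0r //.
rewrite -a0; apply: polyfun_ext => p; apply: aS => i iS.
rewrite /scale_off; have /(_ i iS) yzi := agree_catr yz.
by congr (if _ then _ else _); apply: asbool_equiv_eq; apply: iff_sym.
Qed.

(** On each trace class the numerators restrict one fixed polynomial, whose degree bounds the order
    along every [x]. *)
Lemma spring_order_bound (f : spring) : exists N : nat, forall y x, f y != 0 ->
  exists k a b, [/\ (k <= N)%N, f y = a%:F / b%:F & ord_eq (el x) k a].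
Proof.
have [J fJ] := spring_rational f.
apply: (@finite_traces _ _ el _ _ J); first by constructor; exact: 0%N.
  move=> N M; exists (maxn N M) => y [] H x fy.
    have [k [a [b [kN ? ?]]]] := H x fy; exists k, a, b; split=> //.
    by rewrite leq_max kN.
  have [k [a [b [kN ? ?]]]] := H x fy; exists k, a, b; split=> //.
  by rewrite leq_max kN orbT.
move=> z; have [a [b fab]] := fJ z.
have [N aN] := restr_degree a; exists N => y zy x.
have [b0 ->] := fab y zy; rewrite mulf_eq0 tofrac_eq0 negb_or => /andP[a0 _].
by have [k kN ek] := aN (el x) (el y) a0; exists k, (restr (el y) a),
  (restr (el y) b).
Qed.

(* On each point [x] where [g] vanishes, [f] vanishes too, hence [f ^+ N.+1]
   vanishes to higher order than [g] along every [y] above [x]. *)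
Lemma spring_divides_power (f g : spring) :
  (forall x, f x != 0 -> g x != 0) -> exists n (h : spring), f ^+ n = h * g.
Proof.
move=> fg; have [N gN] := spring_order_bound g.
(* Inverting 0 gives 0, so [h] vanishes wherever [g] does. *)
pose h x := f x ^+ N.+1 / g x.
have cf := spring_compatible (f ^+ N.+1); have cg := spring_compatible g.
have rf := spring_rational (f ^+ N.+1); have rg := spring_rational g.
suff hP : h \in spring_pred.
  exists N.+1, (Spring hP); apply: spring_ext => x.
  rewrite springX springE /= /h; have [g0|g0] := eqVneq (g x) 0.
    by rewrite g0 mulr0 (contraNeq (fg x)) ?g0 ?eqxx // expr0n.
  by rewrite divfK.
apply/asboolP; split=> [x y xy|].
  have [gx0|gx0] := eqVneq (g x) 0.
    have fx0 : f x = 0 by apply: contraNeq (fg x) _; rewrite gx0 eqxx.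
    rewrite /h fx0 expr0n mul0r subr0.
    have [->|gy0] := eqVneq (g y) 0; first by rewrite invr0 mulr0; exact: val_ge0.
    have [k [a [b [kN -> ea]]]] := gN y x gy0.
    apply: val_ge_div ea; apply: (@val_geW _ _ N.+1); first by rewrite addn1.
    apply: val_geX; rewrite -[f y]subr0 -fx0.
    exact: spring_compatible.
  have gy0 := spring_up xy gx0.
  (* As [g x] is nonzero, [v_x(g z)] is 0 for every [z] above [x], so [g z] is a unit of the
     valuation ring. *)
  have unit z : el x `<=` el z -> val_ge (el x) 0 (g z)^-1.
    move=> xz; apply: val_geV; first exact: compatible_val_ge.
    move=> gz; move/eqP: gx0; apply; apply: piecewise_rational_val_ge1 => //.
    have := val_geB gz (cg _ _ xz).
    by rewrite opprB addrC subrK.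
  rewrite /h (div_sub_div _ _ gy0 gx0).
  have E z : f z ^+ N.+1 = (f ^+ N.+1) z by rewrite springX.
  rewrite !E; apply: (@val_geM _ _ 1 0); last first.
    by rewrite invfM; apply: (@val_geM _ _ 0 0); apply: unit.
  apply: val_geB.
    by apply: (@val_geM _ _ 1 0); [exact: cf|exact: piecewise_rational_val_ge].
  by apply: (@val_geM _ _ 0 1); [exact: piecewise_rational_val_ge|exact: cg].
(* The trace on [S] detects the zeros of [g], so on each class [h] is either 0 or the quotient of
   two fixed fractions. *)
have [S gS] := spring_zero_set g.
have [J fJ] := rf; have [L gL] := rg; exists (S ++ J ++ L) => x.
have [a [b fab]] := fJ x; have [c [d gcd]] := gL x.
have [gx0|gx0] := eqVneq (g x) 0.
  exists 0, 1 => y xy; split; first by rewrite restr1 oner_neq0.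
  by rewrite /h (gS x y (agree_catl xy) gx0) invr0 mulr0 restr0 tofrac0 mul0r.
exists (a * d), (b * c) => y xy.
have [b0 fE] := fab y (agree_catl (agree_catr xy)).
have [d0 gE] := gcd y (agree_catr (agree_catr xy)).
have gy0 : g y != 0.
  apply: contraNN gx0 => /eqP gy0; apply/eqP.
  exact: gS (agree_sym (agree_catl xy)) gy0.
have c0 : restr (el y) c != 0.
  by apply: contraNneq gy0 => c0; rewrite gE c0 tofrac0 mul0r.
split; first by rewrite restrM mulf_neq0.
by rewrite /h -springX fE gE !restrM !tofracM invf_div mulf_div.
Qed.

(** For [x] contained in [y], the two restrictions of [a] agree once the variables outside [x] are
    killed, so their difference has positive order. *)
Lemma polyfun_spring_subproof (a : polyfun I) :
  (fun y => (restr (el y) a)%:F) \in spring_pred.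
Proof.
apply/asboolP; split=> [x y xy|].
  rewrite -tofracB -[X in val_ge _ _ X]divr1 -tofrac1.
  exists (restr (el y) a - restr (el x) a), 1, 0%N; split=> //.
    apply/ordge1 => p; rewrite !polyfunE /=.
    by rewrite scale_off_0sub // scale_offM mul0r subrr.
  by rewrite -(restr1 (el x)); apply: ord_eq_restr; rewrite restr1 oner_neq0.
exists [::] => x; exists a, 1 => y _; rewrite /represents restr1.
by rewrite oner_neq0 tofrac1 divr1.
Qed.

Definition polyfun_spring (a : polyfun I) : spring :=
  Spring (polyfun_spring_subproof a).

Lemma proj_subproof (i : I) : (fun p : I -> rat => p i) \in @polynomial_pred I.
Proof. by apply/asboolP; exact: Polynomial_proj. Qed.

Definition coordinate (i : I) : spring :=
  polyfun_spring (Polyfun (proj_subproof i)).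

(** Sums of variables realize the finite unions of sets [U(i)]. Nothing cancels: at the point with
    all coordinates 1, the value counts the entries of [L] that lie in [y]. *)
Lemma sum_coordinates_neq0 (L : seq I) y :
  (\sum_(i <- L) coordinate i) y != 0 <-> exists2 i, i \in L & el y i.
Proof.
pose a : polyfun I := \sum_(i <- L) Polyfun (proj_subproof i).
have aE p : a p = \sum_(i <- L) p i.
  rewrite /a; elim: (L) => [|i s IH]; first by rewrite !big_nil polyfunE.
  by rewrite !big_cons polyfunE IH.
have -> : (\sum_(i <- L) coordinate i) y = (restr (el y) a)%:F.
  rewrite /a; elim: (L) => [|i s IH]; first by rewrite !big_nil restr0 tofrac0.
  by rewrite !big_cons springE IH restrD tofracD.
rewrite tofrac_eq0; split=> [a0|[i iL yi]].
  apply: contrapT => nL; move/eqP: a0; apply; apply: polyfun_ext => p.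
  rewrite polyfunE /= aE big_seq big1 // => i iL; rewrite /scale_off.
  by rewrite asboolF ?mul0r // => yi; apply: nL; exists i.
apply/eqP => /(congr1 (fun b : polyfun I => b (fun=> 1))).
rewrite polyfunE /= aE /scale_off => /eqP; rewrite psumr_eq0.
  by move/allP => /(_ i iL); rewrite asboolT // oner_eq0.
by move=> j _; case: asboolP; rewrite ?mul0r.
Qed.

Lemma coordinate_neq0 i y : coordinate i y != 0 <-> el y i.
Proof.
have := sum_coordinates_neq0 [:: i] y; rewrite big_seq1 => ->.
split=> [[j]|yi]; first by rewrite inE => /eqP ->.
by exists i; rewrite ?mem_head.
Qed.

End Spring.

(** * Spaces of ideals are spectral *)

Section IdealSpace.
Variables (I : choiceType) (X : topologicalType) (el : X -> set I).
Variables (bot : I) (join : I -> I -> I).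
Hypothesis el_inj : injective el.
Hypothesis el_bot : forall x, el x bot.
Hypothesis el_join : forall x i j, el x (join i j) <-> el x i /\ el x j.
(** The order on indices is read off from the points: [j] is below [i] when every point containing
    [i] contains [j]. Each ideal for this order is a point. *)
Hypothesis el_complete : forall T : set I, T bot ->
  (forall i j, T i -> T j -> T (join i j)) ->
  (forall i j, T i -> (forall x, el x i -> el x j) -> T j) ->
  exists x, el x = T.
Hypothesis el_open : forall i, open [set x | el x i].
Hypothesis el_basis : forall (U : set X) x, open U -> U x ->
  exists2 i, el x i & [set y | el y i] `<=` U.

Local Notation R := (spring el).

Lemma principal_ideal i :
  exists x, forall j, el x j <-> forall y, el y i -> el y j.
Proof.
have [|j k jI kI|j k jI jk|x xE] :=
    @el_complete [set j | forall y, el y i -> el y j].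
- by move=> y _; exact: el_bot.
- by move=> y yi; apply/el_join; split; [exact: jI|exact: kI].
- by move=> y yi; apply/jk/jI.
- by exists x => j; rewrite xE.
Qed.

Lemma finite_join (S : seq I) x : exists j, forall y,
  el y j <-> forall i, i \in S -> el x i -> el y i.
Proof.
elim: S => [|i S [j jE]]; first by exists bot.
have [xi|nxi] := pselect (el x i).
  exists (join i j) => y; split.
    move=> /el_join[yi /jE yS] k; rewrite in_cons => /predU1P[->//|].
    exact: yS.
  move=> yS; apply/el_join; split; first by apply: yS; rewrite ?mem_head.
  by apply/jE => k kS; apply: yS; rewrite in_cons kS orbT.
exists j => y; split=> [/jE yS k|yS].
  by rewrite in_cons => /predU1P[->//|]; exact: yS.
by apply/jE => k kS; apply: yS; rewrite in_cons kS orbT.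
Qed.

(** One index per trace suffices. If [j] is the join of the trace of [x] on [S], a point [y] with
    this trace contains the least point [z] of [U(j)], and [z] has the same trace. So [f y != 0]
    gives [f z != 0], hence [f] is nonzero on all of [U(j)]. *)
Lemma nonvanishing_finite (f : R) : exists2 L : seq I,
  forall x, f x != 0 -> exists2 i, i \in L & el x i &
  forall i, i \in L -> forall x, el x i -> f x != 0.
Proof.
suff [L LE] : exists L : seq I, forall x, f x != 0 ->
    exists2 i, i \in L & el x i /\ forall y, el y i -> f y != 0.
  exists [seq i <- L | `[< forall y, el y i -> f y != 0 >]].
    move=> x /LE[i iL [xi fi]]; exists i => //.
    by rewrite mem_filter iL andbT; apply/asboolP.
  by move=> i; rewrite mem_filter => /andP[/asboolP].
have [S fS] := spring_zero_set f.
apply: (@finite_traces _ _ el _ _ S); first by constructor; exact: [::].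
  move=> L L'; exists (L ++ L') => x [] H /H[i iL xi]; exists i => //;
    by rewrite mem_cat iL ?orbT.
move=> x; have [j jE] := finite_join S x; exists [:: j] => y xy fy.
have [z zE] := principal_ideal j.
have fz : f z != 0.
  apply: contraNN fy => /eqP fz; apply/eqP; apply: fS fz => i iS; split.
    by move=> /zE iz; apply/(xy i iS)/iz/jE.
  by move=> /(xy i iS) xi; apply/zE => s /jE; apply.
exists j; first exact: mem_head.
split=> [|t tj]; first by apply/jE => i iS /(xy i iS).
by apply: spring_up fz => i /zE; apply.
Qed.

Definition vanishing_ideal (x : X) : set R := [set f : R | f x = 0].

Lemma vanishing_ideal_prime x : prime_ideal (vanishing_ideal x).
Proof.
split; rewrite /vanishing_ideal /mkset.
- by rewrite springE.
- by move=> f g fx gx; rewrite springE fx gx addr0.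
- by move=> f g gx; rewrite springE gx mulr0.
- by rewrite springE; apply/eqP/oner_neq0.
- by move=> f g; rewrite springE => /eqP; rewrite mulf_eq0 => /orP[]/eqP; auto.
Qed.

Definition point_prime (x : X) : Spec R := MkSpec (vanishing_ideal_prime x).

Section PrimePoint.
Variable p : Spec R.

Lemma prime_exp (f : R) n : spec_ideal p (f ^+ n) -> spec_ideal p f.
Proof.
elim: n => [/(prime_ideal1 (spec_prime p))//|n IH].
by rewrite exprS => /(prime_ideal_prime (spec_prime p))[].
Qed.

(** Here [g] divides a power of [f]; thus membership in a prime depends only on the nonvanishing
    set. *)
Lemma prime_nonvanishing (f g : R) : (forall x, f x != 0 -> g x != 0) ->
  spec_ideal p g -> spec_ideal p f.
Proof.
move=> /spring_divides_power[n [h E]] pg; apply: (@prime_exp _ n); rewrite E.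
exact: prime_idealM (spec_prime p) _ _ pg.
Qed.

Lemma prime_sum (L : seq I) (F : I -> R) :
  (forall i, i \in L -> spec_ideal p (F i)) -> spec_ideal p (\sum_(i <- L) F i).
Proof.
move=> pF; rewrite big_seq; elim/big_ind: _ => //.
  exact: prime_ideal0 (spec_prime p).
exact: prime_idealD (spec_prime p).
Qed.

(** The indices with [t_i] outside [p] form an ideal: [t_bot] vanishes nowhere, and the variable of
    a join is nonzero exactly where both variables are. *)
Lemma prime_point_exists :
  exists x, forall i, el x i <-> ~ spec_ideal p (coordinate el i).
Proof.
have [|i j ni nj|i j ni ij|x xE] :=
    @el_complete [set i | ~ spec_ideal p (coordinate el i)].
- move=> pb; apply: (prime_ideal1 (spec_prime p)).
  by apply: prime_nonvanishing pb => x _; apply/coordinate_neq0.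
- move=> pij.
  have : spec_ideal p (coordinate el i * coordinate el j).
    apply: prime_nonvanishing pij => x.
    rewrite springE mulf_eq0 negb_or => /andP[].
    move=> /coordinate_neq0 xi /coordinate_neq0 xj.
    by apply/coordinate_neq0/el_join.
  by case/(prime_ideal_prime (spec_prime p)).
- move=> pj; apply: ni; apply: prime_nonvanishing pj => x.
  by move=> /coordinate_neq0/ij/coordinate_neq0.
- by exists x => i; rewrite xE.
Qed.

Definition prime_point : X := projT1 (cid prime_point_exists).

Lemma prime_pointE i : el prime_point i <-> ~ spec_ideal p (coordinate el i).
Proof. exact: (projT2 (cid prime_point_exists)). Qed.

End PrimePoint.

Lemma Spec_ext (p q : Spec R) :
  (forall f, spec_ideal p f <-> spec_ideal q f) -> p = q.
Proof.
case: p q => [p pP] [q qP] /= pq; have E : p = q by apply/seteqP; split=> f /pq.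
by case: _ / E qP {pq} => qP; congr MkSpec; exact: Prop_irrelevance.
Qed.

Lemma point_primeK : cancel point_prime prime_point.
Proof.
move=> x; apply: el_inj; apply/seteqP; split=> i.
  by move=> /prime_pointE /eqP /coordinate_neq0.
by move=> xi; apply/prime_pointE/eqP/coordinate_neq0.
Qed.

(** The set [{f <> 0}] is the union of the [U(i)] for [i] in [L]. If [f] vanishes at the point, all
    these [t_i] lie in [p], hence so do their sum and [f]. Otherwise some such [t_i] is outside [p]
    and is nonzero only where [f] is, so [f] is outside [p]. *)
Lemma prime_pointK : cancel prime_point point_prime.
Proof.
move=> p; apply: Spec_ext => f; have [L fL Lf] := nonvanishing_finite f.
split=> [fx0|pf].
  pose g := \sum_(i <- L) coordinate el i.
  apply: (@prime_nonvanishing p f g).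
    by move=> x /fL[i iL xi]; apply/sum_coordinates_neq0; exists i.
  apply: prime_sum => i iL; apply: contrapT => /prime_pointE xi.
  by have /eqP := Lf i iL _ xi.
apply: contrapT => /eqP /fL[i iL /prime_pointE]; apply.
apply: prime_nonvanishing pf => x /coordinate_neq0; exact: Lf.
Qed.

Lemma open_el (U : set X) :
  (forall x, U x -> exists2 i, el x i & [set y | el y i] `<=` U) -> open U.
Proof.
move=> UE; have -> : U = \bigcup_(i in [set i | [set y | el y i] `<=` U])
    [set y | el y i].
  apply/seteqP; split=> [x /UE[i xi iU]|x [i iU xi]]; first by exists i.
  exact: iU.
by apply: bigcup_open => i _; exact: el_open.
Qed.

Lemma point_prime_continuous : continuous point_prime.
Proof.
apply/continuousP => _ [E ->]; apply: open_el => x /existsNP[f /not_implyP[Ef fx]].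
have [L fL Lf] := nonvanishing_finite f.
have [i iL xi] := fL x (introN eqP fx); exists i => // y yi /(_ f Ef) fy.
by have /eqP := Lf i iL y yi.
Qed.

Lemma prime_point_continuous : continuous prime_point.
Proof.
apply/continuousP => U oU.
(* [U] is the union of the [U(i)] inside it, and [U(i)] pulls back to the primes missing [t_i]. *)
exists [set f | exists2 i, f = coordinate el i & [set y | el y i] `<=` U].
apply/seteqP; split=> p /=.
  move=> /(el_basis oU)[i /prime_pointE pi iU] /(_ (coordinate el i)).
  by move=> H; apply/pi/H; exists i.
move=> /existsNP[_ /not_implyP[[i -> iU] pi]].
by apply: iU; apply/prime_pointE.
Qed.

Theorem ideal_space_spectral : spectral_space X.
Proof.
exists R, point_prime, prime_point; split.
- exact: point_prime_continuous.
- exact: prime_point_continuous.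
- exact: point_primeK.
- exact: prime_pointK.
Qed.

End IdealSpace.

(** * Fixed submodules *)

Section SubmoduleSpace.
Variables (K : ttCat) (M : triangulatedCat) (A : ttModule K M).

Lemma SMod_ext (N N' : SMod A) : smod_obj N = smod_obj N' -> N = N'.
Proof.
case: N N' => [L LP] [L' LP'] /= E; case: _ / E LP' => LP'.
by congr MkSMod; exact: Prop_irrelevance.
Qed.

Lemma smod_gen_sub (m : M) (N : SMod A) :
  smod_obj N m -> smod_obj (smod_gen A m) `<=` smod_obj N.
Proof. by move=> Nm n; apply. Qed.

Lemma SMod_openP (V : set (SMod A)) : open V <->
  exists2 D : set (set (SMod A)), D `<=` finI_from (range (smod_U A)) id &
    \bigcup_(W in D) W = V.
Proof. by []. Qed.

Lemma smod_U_open (m : M) : open (smod_U A m).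
Proof.
apply/SMod_openP; exists [set smod_U A m]; last by rewrite bigcup_set1.
by move=> _ ->; apply: (@finI_from1 _ _ _ id); exists m.
Qed.

(** [U(m)] and [U(n)] meet in [U(dsum m n)], and the empty intersection is [U(zob)], so the subbasis
    is already a basis. *)
Lemma SMod_open_basis (V : set (SMod A)) N : open V -> V N ->
  exists2 m, smod_obj N m & smod_U A m `<=` V.
Proof.
move=> /SMod_openP[D DU <-] [W DW WN]; have [E EU EW] := DU W DW.
suff [m Nm mE] : exists2 m, smod_obj N m &
    forall N', smod_obj N' m -> forall U, U \in enum_fset E -> U N'.
  by exists m => // N' mN'; exists W => //; rewrite -EW => U /mE; apply.
have : forall U, U \in enum_fset E -> range (smod_U A) U /\ U N.
  move=> U UE; split; first exact/set_mem/EU.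
  by move: WN; rewrite -EW; apply.
elim: (enum_fset E) => [_|U s IH sU].
  by exists zob => //; exact: thick_zero (smod_thick N).
have [|m Nm ms] := IH; first by move=> W' Ws; apply: sU; rewrite in_cons Ws orbT.
have [[n _ nU] NU] := sU U (mem_head _ _); rewrite -nU in NU.
exists (dsum m n); first by apply/(thick_dsum (smod_thick N)).
move=> N' /(thick_dsum (smod_thick N'))[N'm N'n] W'.
by rewrite in_cons => /predU1P[->|]; [rewrite -nU|exact: ms].
Qed.

Variable c : SMod A -> SMod A.
Hypotheses (cE : extensive c) (cO : order_preserving c) (cF : finite_type c).
Local Notation X := (set_type (smod_fixed c)).

Definition fixed_obj (x : X) : set M := smod_obj (set_val x).

Lemma fixedP (x : X) : c (set_val x) = set_val x.
Proof. by case: x => N NP; exact: set_mem NP. Qed.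

(** An ideal is thick because the third object of a triangle is below the sum of the other two. It
    is fixed because finite type reduces [c] to the [c (smod_gen m)] with [m] in [T], whose objects
    are below [m]: a fixed submodule containing [m] contains them by monotonicity. *)
Lemma fixed_complete (T : set M) : T zob ->
  (forall m n, T m -> T n -> T (dsum m n)) ->
  (forall m n, T m -> (forall x, fixed_obj x m -> fixed_obj x n) -> T n) ->
  exists x, fixed_obj x = T.
Proof.
move=> T0 TD Tle.
have TT : thick_submodule A T.
  split=> //.
  - by move=> a m Tm; apply: Tle Tm _ => x; exact: thick_act (smod_thick _) _ _.
  - move=> m n; split=> [Tmn|[]]; last exact: TD.
    by split; apply: Tle Tmn _ => x /(thick_dsum (smod_thick _))[].
  - move=> x y z f g h fgh Ty Tz; apply: Tle (TD _ _ Ty Tz) _ => N.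
    move=> /(thick_dsum (smod_thick _))[Ny Nz].
    exact: thick_dist1 (smod_thick _) _ _ _ _ _ _ fgh Ny Nz.
  - move=> x y z f g h fgh Tx Tz; apply: Tle (TD _ _ Tx Tz) _ => N.
    move=> /(thick_dsum (smod_thick _))[Nx Nz].
    exact: thick_dist2 (smod_thick _) _ _ _ _ _ _ fgh Nx Nz.
  - move=> x y z f g h fgh Tx Ty; apply: Tle (TD _ _ Tx Ty) _ => N.
    move=> /(thick_dsum (smod_thick _))[Nx Ny].
    exact: thick_dist3 (smod_thick _) _ _ _ _ _ _ fgh Nx Ny.
have cT : smod_fixed c (MkSMod TT).
  apply: SMod_ext; apply/seteqP; split; last exact: cE.
  rewrite cF => n [m Tm cn]; apply: Tle (Tm) _ => x xm.
  by rewrite /fixed_obj -fixedP; apply: cO cn; exact: smod_gen_sub.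
by exists (SigSub (mem_set cT)).
Qed.

Lemma fixed_U_open (m : M) : open (smod_fixed_U c m).
Proof. by exists (smod_U A m) => //; exact: smod_U_open. Qed.

Lemma fixed_basis (U : set X) x : open U -> U x ->
  exists2 m, fixed_obj x m & smod_fixed_U c m `<=` U.
Proof.
move=> [V oV <-] Vx; have [m xm mV] := SMod_open_basis oV Vx.
by exists m => // y; exact: mV.
Qed.

Lemma fixed_obj_inj : injective fixed_obj.
Proof. by move=> x y /SMod_ext; exact: val_inj. Qed.

Lemma fixed_spectral : spectral_space X.
Proof.
(* [{classic M}] gives the objects the choice structure required of an index type. *)
apply: (@ideal_space_spectral {classic M} X fixed_obj zob (@dsum M)).
- exact: fixed_obj_inj.
- by move=> x; exact: thick_zero (smod_thick _).
- by move=> x m n; exact: thick_dsum (smod_thick _) m n.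
- exact: fixed_complete.
- exact: fixed_U_open.
- exact: fixed_basis.
Qed.

Lemma fixed_U_basis : basis (range (smod_fixed_U c)).
Proof.
split; first by move=> _ [m _ <-]; exact: fixed_U_open.
move=> x U; rewrite nbhsE => -[V [oV Vx] VU].
have [m xm mV] := fixed_basis oV Vx; exists (smod_fixed_U c m).
  by split=> //; exists m.
exact: subset_trans mV VU.
Qed.

(** Every neighbourhood of the least point of [U(m)] contains all of [U(m)], so this point is a
    cluster point of each proper filter containing [U(m)]. *)
Lemma fixed_U_compact (m : M) : compact (smod_fixed_U c m).
Proof.
have [|n k nI kI|n k nI nk|x xE] :=
    @fixed_complete [set n | smod_fixed_U c m `<=` smod_fixed_U c n].
- by move=> y _; exact: thick_zero (smod_thick _).
- by move=> y ym; apply/(thick_dsum (smod_thick _)); split; [exact: nI|exact: kI].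
- by move=> y ym; apply/nk/nI.
have xm : fixed_obj x m by rewrite xE.
move=> F FF Fm; exists x; split=> // B V FB; rewrite nbhsE => -[W [oW Wx] WV].
have [n xn nW] := fixed_basis oW Wx.
have [y [yB ym]] := filter_ex (filterI FB Fm).
exists y; split=> //; apply/WV/nW.
by move: xn; rewrite xE; apply.
Qed.

End SubmoduleSpace.

Theorem proposition2p5 (K : ttCat) (M : triangulatedCat) (A : ttModule K M)
    (c : SMod A -> SMod A) :
  extensive c -> order_preserving c -> finite_type c ->
  [/\ spectral_space (set_type (smod_fixed c)),
      basis (range (smod_fixed_U c)) &
      forall m : M, compact (smod_fixed_U c m)].
Proof.
move=> cE cO cF; split; first exact: fixed_spectral.
  exact: fixed_U_basis.
exact: fixed_U_compact.
Qed.
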